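(* Let $L$ be a nonempty continuous dcpo. Then the following are equivalent: (a) for every RW-space $X$, the Isbell topology and the Scott topology on $C(X,L)$ coincide, i.e. $\operatorname{Is}(C(X,L))=\sigma(C(X,L))$; (b) $L$ is a pointed continuous $L$-domain.
   Context: Directed sets are nonempty. A dcpo is a poset in which every directed subset has a supremum. For $u,x$ in a dcpo $P$, $u\ll x$ means that whenever $D\subseteq P$ is directed and $x\le\sup D$, some $d\in D$ satisfies $u\le d$. $P$ is continuous if for every $x\in P$ the set $\{u:u\ll x\}$ is directed with supremum $x$. A dcpo is pointed if it has a least element. A dcpo $P$ is an $L$-dcpo if for every $x\in P$ the principal ideal $\{y\in P:y\le x\}$ is a complete lattice; a (continuous) $L$-domain is a continuous $L$-dcpo. A subset of a dcpo $P$ is Scott open if it is upward closed and inaccessible by directed suprema; $\sigma(P)$ is the topology of Scott-open sets. For a topological space $X$, $\mathcal O(X)$ is its lattice of open sets ordered by inclusion; $X$ is core compact if $\mathcal O(X)$ is a continuous dcpo. $C(X,L)$ is the set of continuous maps from $X$ to $(L,\sigma(L))$, ordered pointwise; it is a dcpo with directed suprema computed pointwise, and $\sigma(C(X,L))$ is its Scott topology. The Isbell topology $\operatorname{Is}(C(X,L))$ is generated (as a subbase) by the sets $[\mathcal H,V]=\{f\in C(X,L):f^{-1}(V)\in\mathcal H\}$, where $\mathcal H\subseteq\mathcal O(X)$ is Scott open in $\mathcal O(X)$ and $V\in\sigma(L)$. RW-spaces: a decomposition of a nonempty open set $V$ is a family of pairwise disjoint nonempty open sets whose union is $V$. Let $V\subseteq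 U$ be nonempty open sets. A decomposition $\mathcal A$ of $V$ is relatively maximal to $U$ if, for every decomposition $\mathcal B$ of $U$ and every $B\in\mathcal B$ meeting $V$, $B\cap V=\bigcup\{A\in\mathcal A:A\cap B\neq\varnothing\}$. A space $X$ has property RW if, whenever $V_i\ll U_i$ in $\mathcal O(X)$ for $1\le i\le k$ (with $k\ge1$) and $\bigcap_{i=1}^kV_i\neq\varnothing$, the open set $\bigcap_{i=1}^kV_i$ has a finite decomposition relatively maximal to $\bigcap_{i=1}^kU_i$. An RW-space is a core-compact space with property RW. *)

(* Defs.v *)
From HB Require Import structures.
From mathcomp Require Import all_boot all_order.
From mathcomp Require Import all_classical.
From mathcomp Require Import topology_structure.

Set Implicit Arguments.
Unset Strict Implicit.
Unset Printing Implicit Defensive.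

Import Order.TTheory.

Local Open Scope order_scope.
Local Open Scope classical_set_scope.

Section Domains.
Context {d : Order.disp_t} {P : porderType d}.
Implicit Types (D U : set P) (s u x y z : P).

Definition directed D :=
  D !=set0 /\
  forall x y, D x -> D y -> exists z, [/\ D z, x <= z & y <= z].

Definition way_below u x :=
  forall D s, directed D -> supremums D s -> x <= s -> exists2 v, D v & u <= v.

Definition scott_open U :=
  (forall x y, x <= y -> U x -> U y) /\
  (forall D s, directed D -> supremums D s -> U s -> D `&` U !=set0).

Lemma scott_openT : scott_open setT.
Proof. by split=> // D s [[x Dx] _] _ _; exists x. Qed.

Lemma scott_openI : setI_closed scott_open.
Proof.
move=> U V [Uup Uacc] [Vup Vacc]; split.
  by move=> x y xy [Ux Vx]; split; [exact: Uup Ux|exact: Vup Vx].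
move=> D s dirD sups [Us Vs].
have [x [Dx Ux]] := Uacc _ _ dirD sups Us.
have [y [Dy Vy]] := Vacc _ _ dirD sups Vs.
have [z [Dz xz yz]] := dirD.2 _ _ Dx Dy.
by exists z; split=> //; split; [exact: Uup Ux|exact: Vup Vy].
Qed.

Lemma scott_open_bigcup (I : Type) (f : I -> set P) :
  (forall i, scott_open (f i)) -> scott_open (\bigcup_i f i).
Proof.
move=> fo; split.
  by move=> x y xy [i _ fix_]; exists i => //; exact: (fo i).1 fix_.
move=> D s dirD sups [i _ fis].
have [x [Dx fix_]] := (fo i).2 _ _ dirD sups fis.
by exists x; split=> //; exists i.
Qed.

End Domains.

Section DomainProperties.
Context {d : Order.disp_t}.
Implicit Types P : porderType d.

Definition dcpo P :=
  forall D : set P, directed D -> exists s, supremums D s.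

Definition continuous_dcpo P :=
  dcpo P /\
  forall x : P, directed [set u | way_below u x] /\
                supremums [set u | way_below u x] x.

Definition pointed_dcpo P := dcpo P /\ exists b : P, forall x : P, b <= x.

Definition complete_lattice P :=
  forall A : set P,
    (exists s, supremums A s) /\ (exists i, infimums A i).

Definition principal_ideal P (x : P) : Type := {y : P | y <= x}.

End DomainProperties.

HB.instance Definition _ d (P : porderType d) (x : P) :=
  SubChoice.on (principal_ideal x).
HB.instance Definition _ d (P : porderType d) (x : P) :=
  [SubChoice_isSubPOrder of principal_ideal x by <: with d].

Definition L_dcpo d (P : porderType d) :=
  dcpo P /\ forall x : P, complete_lattice (principal_ideal x).

Definition continuous_L_domain d (P : porderType d) :=
  continuous_dcpo P /\ L_dcpo P.

(* [scott P] is [P] with its Scott topology. *)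
Definition scott d (P : porderType d) : Type := P.

HB.instance Definition _ d (P : porderType d) := Order.POrder.on (scott P).
HB.instance Definition _ d (P : porderType d) :=
  isOpenTopological.Build (scott P)
    scott_openT scott_openI (@scott_open_bigcup d P).

Definition scott_topology d (P : porderType d) : set (set P) :=
  @open (scott P).
Arguments scott_topology {d} P.

Lemma scott_topologyE d (P : porderType d) :
  scott_topology P = @scott_open d P.
Proof. by []. Qed.

(* The lattice of open sets, ordered by inclusion (the order of [set X]). *)
Definition opens (X : topologicalType) : Type := set_type (@open X).

HB.instance Definition _ (X : topologicalType) := SubChoice.on (opens X).
HB.instance Definition _ (X : topologicalType) :=
  [SubChoice_isSubPOrder of opens X by <: with set_display].

Lemma opens_leE (X : topologicalType) (U V : opens X) :
  (U <= V) = (val U `<=` val V) :> Prop.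
Proof. by rewrite -subsetEset leEsub. Qed.

Definition core_compact (X : topologicalType) := continuous_dcpo (opens X).

Section RW.
Context {X : topologicalType}.
Implicit Types (U V : set X) (F G : set (set X)).

Definition decomposition F V :=
  [/\ V !=set0, forall A, F A -> open A /\ A !=set0, trivIset F id &
      \bigcup_(A in F) A = V].

(* Meant for [F] a decomposition of [V], with [V `<=` U]. *)
Definition relatively_maximal F V U :=
  forall G, decomposition G U -> forall B, G B -> B `&` V !=set0 ->
    B `&` V = \bigcup_(A in [set A | F A /\ A `&` B !=set0]) A.

End RW.

Definition property_RW (X : topologicalType) :=
  forall (k : nat) (V U : 'I_k -> opens X), (0 < k)%N ->
    (forall i, way_below (V i) (U i)) ->
    \bigcap_i val (V i) !=set0 ->
    exists F : set (set X),
      [/\ finite_set F, decomposition F (\bigcap_i val (V i)) &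
          relatively_maximal F (\bigcap_i val (V i)) (\bigcap_i val (U i))].

Definition RW_space (X : topologicalType) := core_compact X /\ property_RW X.

(* Continuous maps from [X] to [scott L], with the pointwise order. *)
Definition cmap (X : topologicalType) d (L : porderType d) : Type :=
  continuousType X (scott L).

HB.instance Definition _ (X : topologicalType) d (L : porderType d) :=
  Choice.on (cmap X L).

Section PointwiseOrder.
Context (X : topologicalType) (d : Order.disp_t) (L : porderType d).
Implicit Types f g h : cmap X L.

Definition cmap_le f g : bool := `[< forall x : X, f x <= g x >].

Lemma cmap_le_refl : reflexive cmap_le.
Proof. by move=> f; apply/asboolP => x. Qed.

Lemma cmap_le_anti : antisymmetric cmap_le.
Proof.
move=> f g /andP[/asboolP fg /asboolP gf]; apply/continuousEP => x.
by apply/le_anti; rewrite fg gf.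
Qed.

Lemma cmap_le_trans : transitive cmap_le.
Proof.
move=> g f h /asboolP fg /asboolP gh; apply/asboolP => x.
exact: le_trans (fg x) (gh x).
Qed.

HB.instance Definition _ := Order.Le_isPOrder.Build d (cmap X L)
  cmap_le_refl cmap_le_anti cmap_le_trans.

Lemma cmap_leP f g : reflect (forall x : X, f x <= g x) (f <= g).
Proof. exact: asboolP. Qed.

End PointwiseOrder.

Lemma open_preimage (X Y : topologicalType) (f : continuousType X Y)
    (V : opens Y) :
  f @^-1` val V \in @open X.
Proof.
by apply/mem_set; apply: open_comp (set_mem (valP V)) => x _; exact: cts_fun.
Qed.

Definition preimage_opens (X Y : topologicalType) (f : continuousType X Y)
    (V : opens Y) : opens X :=
  Sub (f @^-1` val V) (open_preimage f V).

Section Isbell.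
Context (X : topologicalType) (d : Order.disp_t) (L : porderType d).

Definition isbell_subbasic (H : set (opens X)) (V : opens (scott L)) :
    set (cmap X L) :=
  [set f : cmap X L | H (preimage_opens f V)].

Definition isbell_subbase : set (set (cmap X L)) :=
  [set B | exists (H : set (opens X)) (V : opens (scott L)),
             scott_open H /\ B = isbell_subbasic H V].

(* [isbell] is [cmap X L] with the topology generated by [isbell_subbase]. *)
Definition isbell : Type := cmap X L.

HB.instance Definition _ := Choice.on isbell.
HB.instance Definition _ :=
  isSubBaseTopological.Build isbell isbell_subbase (@id (set isbell)).

Definition isbell_topology : set (set (cmap X L)) := @open isbell.

End Isbell.
Arguments isbell_topology X {d} L.

(* Main.v *)
From HB Require Import structures.
Require Import Defs.
From mathcomp Require Import all_boot all_order finmap.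
From mathcomp Require Import all_classical.
From mathcomp Require Import topology_structure.
From mathcomp Require Import wochoice.

Set Implicit Arguments.
Unset Strict Implicit.
Unset Printing Implicit Defensive.

Import Order.TTheory.

Local Open Scope order_scope.
Local Open Scope classical_set_scope.

(** Why the two topologies agree over a pointed L-domain. Isbell-open sets are
    always Scott open ([isbell_subset_scott]). Conversely, let [f] belong to a
    Scott-open set. Choose finitely many values [a i] and open sets
    [V i << f^-1 (way above (a i))], and send [x] to the supremum, computed in
    the principal ideal of [f x], of the [a i] with [x] in [V i]. Such a
    supremum does not change when [f x] is replaced by a smaller bound of these
    values, so these step functions are continuous; they are directed with
    supremum [f], and one of them, [g], lies in the Scott-open set. What is
    needed is an Isbell neighbourhood of [f] all of whose members lie above [g].
    Interpolate [V i << W i << f^-1 (way above (a i))]. If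
    [W i << h^-1 (way above (a i))], then [h] exceeds the right [a i] on the
    intersection of the [W i], but their supremum below [h x] may differ from
    their supremum below [f x]. Both suprema are locally constant on this
    intersection, hence constant on each of the finitely many pieces into which
    property RW cuts the intersection of the [V i]. It is therefore enough to
    control [h] at one point of each piece ([near_step_le]).

    Why coincidence forces [L] to be a pointed L-domain. If it fails to be one,
    some nonempty set of elements of [L] has no least element: [L] itself, or the
    set of bounds, in a principal ideal, of two elements that have no supremum
    there. From such a set one builds a set [Y] and an upward closed set [W] of functions
    from [Y] to [L] that contains a constant function, behaves like a
    Scott-open set, and is not determined near that constant by finitely many
    values ([separates]). If two elements have no common lower bound this is done
    with [Y] countable ([separating_pair]); otherwise there is a well-ordered
    family without lower bound all of whose initial segments have one, and the
    powerset of the index set serves as [Y], by a transfinite diagonal argument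
    ([separating_chain]). In an Alexandrov space an Isbell-open set constrains
    only finitely many values ([alexandrov_isbell_open]), so the set of maps
    given by [W] is Scott open and not Isbell open
    ([separates_isbell_neq_scott]). The discrete space on [Y] yields a least
    element ([isbell_scott_pointed]). For suprema, [Y] is placed above two points
    and below a greatest one: the values at the two lower points bound all others
    from below, and the greatest point makes property RW trivial
    ([isbell_scott_local_sup]).

    In the second case the values at the two lower points can be prescribed
    only up to approximation, so it matters where a lower bound is missing.
    [separating_levels] finds two successive approximations [q << q'] such that
    a family has no lower bound at level [q] while its initial segments have
    some at level [q']; such levels are found by considering, over all levels, a
    shortest initial segment without lower bound. *)

(** * Way-below in continuous dcpos *)

Section WayBelow.
Context {d : Order.disp_t} {P : porderType d}.
Implicit Types (D B : set P) (u v w x y z : P).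

Lemma directed1 x : directed [set x].
Proof. by split=> [|_ _ -> ->]; exists x. Qed.

Lemma way_below_le u x : way_below u x -> u <= x.
Proof.
move=> ux; have [|_ ->//] := ux [set x] x (directed1 x) _ (lexx x).
by rewrite supremums1.
Qed.

Lemma le_way_below u v x y :
  u <= v -> way_below v x -> x <= y -> way_below u y.
Proof.
move=> uv vx xy D s dirD supD ys.
have [w Dw vw] := vx D s dirD supD (le_trans xy ys).
by exists w => //; exact: le_trans vw.
Qed.

Lemma continuous_dcpo_of_basis :
  dcpo P ->
  (forall x, exists B, [/\ directed B, supremums B x &
                           forall u, B u -> way_below u x]) ->
  continuous_dcpo P.
Proof.
move=> dcpoP basisP; split=> // x.
have [B [dirB supB Bx]] := basisP x; split; first split.
- by have [[b Bb] _] := dirB; exists b; exact: Bx.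
- move=> u v /= ux vx.
  have [u' Bu' uu'] := ux B x dirB supB (lexx x).
  have [v' Bv' vv'] := vx B x dirB supB (lexx x).
  have [w [Bw u'w v'w]] := dirB.2 _ _ Bu' Bv'.
  exists w; split; [exact: Bx|exact: le_trans u'w|exact: le_trans v'w].
- split=> [u /way_below_le//|y uby].
  by apply: supB.2 => u Bu; apply: uby; exact: Bx.
Qed.

Section Continuous.
Hypothesis contP : continuous_dcpo P.

(** The elements [u] with [u << w << x] for some [w] already form a directed
    set with supremum [x]; hence one of them lies above any given element
    way below [x]. *)
Lemma way_below_interpolation u x :
  way_below u x -> exists w, way_below u w /\ way_below w x.
Proof.
move=> ux; pose D := [set c | exists w, way_below c w /\ way_below w x].
have dirD : directed D.
  have [[w wx] dirx] := (contP.2 x).1; split.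
    by have [[c cw] _] := (contP.2 w).1; exists c, w.
  move=> c1 c2 [w1 [c1w1 w1x]] [w2 [c2w2 w2x]].
  have [w' [w'x w1w' w2w']] := dirx _ _ w1x w2x.
  have [c [cw' c1c c2c]] := (contP.2 w').1.2 _ _
    (le_way_below (lexx _) c1w1 w1w') (le_way_below (lexx _) c2w2 w2w').
  by exists c; split=> //; exists w'.
have supD : supremums D x.
  split=> [c [w [/way_below_le cw /way_below_le wx]]|y uby].
    exact: le_trans wx.
  apply: (contP.2 x).2.2 => w wx; apply: (contP.2 w).2.2 => c cw.
  by apply: uby; exists w.
have [c [w [cw wx]] uc] := ux D x dirD supD (lexx x).
by exists w; split=> //; exact: le_way_below uc cw (lexx w).
Qed.

Lemma scott_open_way_above u : scott_open [set x | way_below u x].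
Proof.
split=> [x y xy ux|D s dirD supD us]; first exact: le_way_below (lexx u) ux xy.
have [w [uw ws]] := way_below_interpolation us.
have [x Dx wx] := ws D s dirD supD (lexx s).
by exists x; split=> //; exact: le_way_below (lexx u) uw wx.
Qed.

Lemma way_below_upper2 u v x : way_below u x -> way_below v x ->
  exists w, [/\ way_below w x, u <= w & v <= w].
Proof. exact: (contP.2 x).1.2. Qed.


End Continuous.
End WayBelow.

(** * Open sets and continuous maps as dcpos *)

Section OpensDcpo.
Context {X : topologicalType}.
Implicit Types (D : set (opens X)) (U V : opens X).

Definition mkopens (A : set X) (oA : open A) : opens X :=
  Sub A (mem_set oA).

Lemma opens_open U : open (val U).
Proof. exact: set_mem (valP U). Qed.

Lemma near_opens U x : val U x -> \forall y \near x, val U y.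
Proof. by move=> Ux; apply: open_nbhs_nbhs; split=> //; exact: opens_open. Qed.

Lemma open_bigcup_val D : open (\bigcup_(V in D) val V).
Proof. by apply: bigcup_open => V _; exact: opens_open. Qed.

Lemma opens_supremumsE D U :
  supremums D U -> val U = \bigcup_(V in D) val V.
Proof.
move=> [ubU lubU]; apply/seteqP; split=> [x|x [V DV]]; last first.
  by have := ubU V DV; rewrite opens_leE; apply.
have : U <= mkopens (open_bigcup_val D).
  by apply: lubU => V DV; rewrite opens_leE => y Vy; exists V.
by rewrite opens_leE; apply.
Qed.

Lemma opens_supremums D U :
  val U = \bigcup_(V in D) val V -> supremums D U.
Proof.
move=> eqU; split=> V.
  by move=> DV; rewrite opens_leE eqU => y Vy; exists V.
move=> ubV; rewrite opens_leE eqU => y [W DW Wy].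
by have := ubV W DW; rewrite opens_leE; apply.
Qed.

Lemma opens_dcpo : dcpo (opens X).
Proof.
by move=> D _; exists (mkopens (open_bigcup_val D)); exact: opens_supremums.
Qed.

Lemma scott_open_point x : scott_open [set U : opens X | val U x].
Proof.
split=> [U V|D U _ supD /=]; first by rewrite opens_leE => UV; exact: UV.
by rewrite (opens_supremumsE supD) => -[V DV Vx]; exists V.
Qed.

Lemma core_compact_nbhs U x : core_compact X -> val U x ->
  exists V, way_below V U /\ val V x.
Proof.
move=> ccX; rewrite (opens_supremumsE (ccX.2 U).2) => -[V VU Vx].
by exists V.
Qed.

End OpensDcpo.

Section CmapSup.
Context {X : topologicalType} {d : Order.disp_t} {L : porderType d}.
Implicit Types (D : set (cmap X L)) (f g : cmap X L).

Lemma scott_open_preimage f (Q : set L) : scott_open Q -> open (f @^-1` Q).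
Proof.
move=> oQ; have := opens_open (preimage_opens f (mkopens (X := scott L) oQ)).
by [].
Qed.

Lemma cmap_of (f : X -> L) :
  (forall Q, scott_open Q -> open (f @^-1` Q)) ->
  exists g : cmap X L, forall x, g x = f x.
Proof.
move=> f_open.
have f_cts : continuous (f : X -> scott L) by apply/continuousP.
by exists (mkcts f_cts).
Qed.

Hypothesis dcpoL : dcpo L.

Lemma directed_at D x : directed D -> directed [set f x | f in D].
Proof.
move=> [[f Df] dirD]; split; first by exists (f x), f.
move=> _ _ [g Dg <-] [h Dh <-].
have [k [Dk /cmap_leP gk /cmap_leP hk]] := dirD _ _ Dg Dh.
by exists (k x); split=> //; exists k.
Qed.

Lemma cmap_pointwise_sup D : directed D ->
  exists g, forall x, supremums [set f x | f in D] (g x).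
Proof.
move=> dirD; have /choice[g gP] x := dcpoL (directed_at x dirD).
have [Q oQ|h hg] := @cmap_of g; last by exists h => x; rewrite hg; exact: gP.
have -> : g @^-1` Q = \bigcup_(f in D) (f @^-1` Q).
  apply/seteqP; split=> [x Qgx|x [f Df Qfx]].
    have [_ [[f Df <-] Qfx]] := oQ.2 _ _ (directed_at x dirD) (gP x) Qgx.
    by exists f.
  by apply: oQ.1 Qfx; apply: (gP x).1; exists f.
by apply: bigcup_open => f _; exact: scott_open_preimage.
Qed.

Lemma cmap_supremums_at D g x : directed D -> supremums D g ->
  supremums [set f x | f in D] (g x).
Proof.
move=> dirD supg; have [h hP] := cmap_pointwise_sup dirD.
suff -> : g = h by exact: hP.
apply: is_subset1_supremums supg _; split=> [f Df|k ubk]; apply/cmap_leP => y.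
  by apply: (hP y).1; exists f.
by apply: (hP y).2 => _ [f Df <-]; have /cmap_leP := ubk f Df; apply.
Qed.

End CmapSup.

(** * The Isbell topology *)

Section IsbellTopology.
Context {X : topologicalType} {d : Order.disp_t} {L : porderType d}.
Implicit Types (f g h : cmap X L) (O : set (cmap X L)).

Lemma isbell_subbasic_open (H : set (opens X)) (V : opens (scott L)) :
  scott_open H -> isbell_topology X L (isbell_subbasic H V).
Proof.
move=> oH; have sB : @isbell_subbase X d L (isbell_subbasic H V) by exists H, V.
exists [set isbell_subbasic H V]; last by rewrite bigcup_set1.
by move=> _ ->; exact: (@finI_from1 _ _ (@isbell_subbase X d L) id).
Qed.

(** Reduces to subbasic sets the two facts needed about arbitrary Isbell-open
    sets: that they are Scott open, and that over an Alexandrov space they only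
    constrain finitely many values. *)
Lemma isbell_open_ind (P : set (cmap X L) -> Prop) :
    P setT -> (forall A B, P A -> P B -> P (A `&` B)) ->
    (forall (I : Type) (A : I -> set (cmap X L)),
      (forall i, P (A i)) -> P (\bigcup_i A i)) ->
    (forall H V, scott_open H -> P (isbell_subbasic H V)) ->
  forall O, isbell_topology X L O -> P O.
Proof.
move=> PT PI PU PB _ [D subD <-].
have PD A : D A -> P A.
  move=> /subD[E subE <-].
  rewrite bigcap_fset.
  rewrite big_seq; elim/big_ind : _ => // B BE.
  have /set_mem[H [V [oH ->]]] := subE _ BE.
  exact: PB.
suff -> : \bigcup_(i in D) id i = \bigcup_(i : {A | D A}) projT1 i.
  by apply: PU => -[A DA]; exact: PD.
apply/seteqP; split=> [f [A DA Af]|f [[A DA] _ Af]]; last by exists A.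
by exists (exist _ A DA).
Qed.

(** Directed suprema of continuous maps are pointwise, so taking preimages of
    a Scott-open set commutes with them. *)
Lemma isbell_subset_scott :
  dcpo L -> isbell_topology X L `<=` scott_topology (cmap X L).
Proof.
move=> dcpoL; apply: isbell_open_ind.
- exact: scott_openT.
- exact: scott_openI.
- exact: scott_open_bigcup.
move=> H V oH; split=> [f g /cmap_leP fg|D s dirD supD Hs].
  apply: oH.1; rewrite opens_leE => x /=.
  exact: (opens_open V).1 (fg x).
pose DV := [set preimage_opens f V | f in D].
have dirDV : directed DV.
  split; first by have [[f Df] _] := dirD; exists (preimage_opens f V), f.
  move=> _ _ [f Df <-] [g Dg <-].
  have [h [Dh /cmap_leP fh /cmap_leP gh]] := dirD.2 _ _ Df Dg.
  exists (preimage_opens h V); rewrite !opens_leE; split; first by exists h.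
    by move=> x; exact: (opens_open V).1 (fh x).
  by move=> x; exact: (opens_open V).1 (gh x).
have supDV : supremums DV (preimage_opens s V).
  apply: opens_supremums; apply/seteqP; split=> x /=.
    move=> /((opens_open V).2 _ _ (directed_at x dirD)
             (cmap_supremums_at dcpoL x dirD supD)).
    by move=> [_ [[f Df <-] Vfx]]; exists (preimage_opens f V) => //; exists f.
  move=> [_ [f Df <-]]; apply: (opens_open V).1.
  by apply: (cmap_supremums_at dcpoL x dirD supD).1; exists f.
by have [_ [[f Df <-] HV]] := oH.2 _ _ dirDV supDV Hs; exists f.
Qed.

End IsbellTopology.

(** * Suprema relative to a principal ideal *)

Section LocalSup.
Context {d : Order.disp_t} {L : porderType d}.
Implicit Types (A B : set L) (a c w y z : L).

Definition local_sup y A c :=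
  [/\ c <= y, ubound A c & forall w, w <= y -> ubound A w -> c <= w].

(** The value is [y] when there is no such supremum; in an L-dcpo this only
    happens when [y] is not a bound of [A]. *)
Definition lsup y A : L := xget y (local_sup y A).

Lemma local_sup_uniq y A c1 c2 :
  local_sup y A c1 -> local_sup y A c2 -> c1 = c2.
Proof.
move=> [c1y ub1 le1] [c2y ub2 le2]; apply/le_anti.
by rewrite le1 //= le2.
Qed.

Hypothesis LL : L_dcpo L.

Lemma lsupP y A : ubound A y -> local_sup y A (lsup y A).
Proof.
move=> uby; apply: xgetPex.
have [[s [ubs lubs]] _] := LL.2 y [set w | A (val w)].
exists (val s); split=> [|a Aa|w wy ubw].
- exact: (valP s).
- have ay := uby a Aa.
  by have := ubs (Sub a ay) Aa; rewrite -Order.le_val.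
- have := lubs (Sub w wy) _; rewrite -Order.le_val; apply.
  by move=> [a ay] /= Aa; rewrite -Order.le_val; exact: ubw.
Qed.

Lemma lsup_le y A : ubound A y -> lsup y A <= y.
Proof. by case/lsupP. Qed.

Lemma lsup_ubound y A : ubound A y -> ubound A (lsup y A).
Proof. by case/lsupP. Qed.

Lemma lsup_least y A w : ubound A w -> w <= y -> lsup y A <= w.
Proof.
move=> ubw wy; have uby : ubound A y by move=> a /ubw aw; exact: le_trans wy.
by have [_ _] := lsupP uby; apply.
Qed.

(** The supremum computed below [z] is smaller than every bound of [A] below
    [z], in particular than [y], so it is already the supremum below [y].
    Incomparable bounds may give different suprema: this is why maps that
    exceed the same values need not exceed the same suprema. *)
Lemma lsup_up y z A : ubound A y -> y <= z -> lsup y A = lsup z A.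
Proof.
move=> uby yz.
have ubz : ubound A z by move=> a /uby ay; exact: le_trans yz.
apply: local_sup_uniq (lsupP uby) _; have [cz ubc lec] := lsupP ubz.
split=> // [|w wy]; first exact: lec.
by apply: lec; exact: le_trans yz.
Qed.

Lemma lsup_subset y A B : A `<=` B -> ubound B y -> lsup y A <= lsup y B.
Proof.
move=> AB uby; apply: lsup_least; last exact: lsup_le.
by move=> a /AB; exact: lsup_ubound.
Qed.

End LocalSup.

Section FiniteUpperBound.
Context {d : Order.disp_t} {L : porderType d}.

Lemma way_below_finite_ubound (y : L) (s : seq L) : continuous_dcpo L ->
  (forall a, a \in s -> way_below a y) ->
  exists b, way_below b y /\ ubound [set` s] b.
Proof.
move=> contL; elim: s => [_|a s IHs s_y].
  by have [[b yb] _] := (contL.2 y).1; exists b.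
have [|b [yb ubb]] := IHs; first by move=> c sc; apply: s_y; rewrite inE sc orbT.
have [|w [wy aw bw]] := way_below_upper2 contL _ yb (u := a).
  by apply: s_y; rewrite mem_head.
exists w; split=> // c /=; rewrite inE => /predU1P[->//|sc].
exact: le_trans (ubb c sc) bw.
Qed.

End FiniteUpperBound.

Section RelativelyMaximal.
Context {X : topologicalType}.

(** The fibres of a locally constant map decompose [U], and relative maximality
    puts each piece of [F] inside a single member of any decomposition of [U]. *)
Lemma relatively_maximal_constant (T : Type) (s : X -> T) (F : set (set X))
    (V U A : set X) x y :
  open U -> V `<=` U -> (forall x, U x -> \forall z \near x, s z = s x) ->
  decomposition F V -> relatively_maximal F V U -> F A -> A x -> A y ->
  s x = s y.
Proof.
move=> oU VU s_loc [_ _ _ FV] Fmax FA Ax Ay.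
have AV z : A z -> V z by move=> Az; rewrite -FV; exists A.
pose fibre z := U `&` [set w | s w = s z].
have decU : decomposition [set fibre z | z in U] U.
  split.
  - by exists x; apply/VU/AV.
  - move=> _ [z Uz <-]; split; last by exists z.
    rewrite openE => w [Uw sw].
    have : \forall v \near w, U v /\ s v = s w.
      apply: filterI; last exact: s_loc.
      by move: Uw; move: oU; rewrite openE; apply.
    by apply: filterS => v [Uv sv]; split=> //=; rewrite sv sw.
  - move=> _ _ [z Uz <-] [w Uw <-] [v [[_ /= vz] [_ /= vw]]].
    by rewrite /fibre -vz -vw.
  - apply/seteqP; split=> [w [_ [z Uz <-] [//]]|w Uw].
    by exists (fibre w) => //; exists w.
have Ux : U x by apply/VU/AV.
have fibre_x : [set fibre z | z in U] (fibre x) by exists x.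
have fibre_V : fibre x `&` V !=set0 by exists x; split; [split|exact: AV].
have /seteqP[_ /(_ y)[|[_ /= ->]//]] := Fmax _ decU _ fibre_x fibre_V.
by exists A => //; split=> //; exists x; split.
Qed.

End RelativelyMaximal.

(** * Scott-open sets of maps into a pointed L-domain *)

Section StepFunctions.
Context {X : topologicalType} {d : Order.disp_t} {L : porderType d}.
Hypotheses (contL : continuous_dcpo L) (LL : L_dcpo L).
Implicit Types (f g h : cmap X L) (p : seq (opens X * L)) (a b : L).

Definition way_above a : opens (scott L) :=
  mkopens (X := scott L) (scott_open_way_above contL a).

(** Step functions are described by finite lists of pairs (open set, value);
    these are the values to be combined at [x]. *)
Definition active p x : set L :=
  [set a | a \in [seq q.2 | q <- p & x \in val q.1]].

Lemma activeP p x a : active p x a <-> exists2 V, (V, a) \in p & val V x.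
Proof.
split=> [/mapP[[V b]]|[V Vp Vx]].
  by rewrite mem_filter => /andP[/set_mem Vx Vp] ->; exists V.
by apply/mapP; exists (V, a) => //; rewrite mem_filter Vp mem_set.
Qed.

Definition way_steps f p := forall V a, (V, a) \in p ->
  way_below V (preimage_opens f (way_above a)).

Definition step f p x : L := lsup (L := L) (f x) (active p x).

Lemma active_way_below f p x a : way_steps f p -> active p x a ->
  way_below a (f x).
Proof.
move=> fp /activeP[V Vp Vx]; have /way_below_le := fp V a Vp.
by rewrite opens_leE => /(_ x Vx).
Qed.

Lemma active_ubound f p x : way_steps f p -> ubound (active p x) (f x).
Proof. by move=> fp a /(active_way_below fp) /way_below_le. Qed.

Lemma near_active p x : \forall y \near x, active p x `<=` active p y.
Proof.
elim: p => [|[V a] p IHp]; first by apply: filterE => y z /activeP[].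
have [Vx|nVx] := pselect (val V x); last first.
  apply: filterS IHp => y xy b /activeP[W]; rewrite inE => /predU1P[[-> _]//|Wp Wx].
  have /xy/activeP[W' W'p W'y] : active p x b by apply/activeP; exists W.
  by apply/activeP; exists W'; rewrite // inE W'p orbT.
apply: filterS2 IHp (near_opens Vx) => y xy Vy b /activeP[W].
rewrite inE => /predU1P[[_ ->] _|Wp Wx].
  by apply/activeP; exists V; rewrite // mem_head.
have /xy/activeP[W' W'p W'y] : active p x b by apply/activeP; exists W.
by apply/activeP; exists W'; rewrite // inE W'p orbT.
Qed.

(** A bound [b << f x] of the active values remains a bound near [x], so that
    the relative supremum of these values does not change near [x]. *)
Lemma near_lsup f x (A : set L) b : way_below b (f x) -> ubound A b ->
  \forall y \near x, lsup (L := L) (f y) A = lsup (L := L) (f x) A.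
Proof.
move=> bx ubb.
have near_b : \forall y \near x, way_below b (f y).
  exact: near_opens (bx : val (preimage_opens f (way_above b)) x).
apply: filterS near_b => y /way_below_le by_.
by rewrite -(lsup_up LL ubb by_); apply: lsup_up => //; exact: way_below_le.
Qed.

(** Near [x] the active values can only increase in number, and the relative
    supremum of those active at [x] stays the same. *)
Lemma step_continuous f p : way_steps f p ->
  exists g : cmap X L, forall x, g x = step f p x.
Proof.
move=> fp; apply: cmap_of => Q oQ; rewrite openE => x Qx.
have [b [bx ubb]] : exists b, way_below b (f x) /\ ubound (active p x) b.
  by apply: way_below_finite_ubound contL _ => a; exact: active_way_below.
apply: filterS2 (near_active p x) (near_lsup bx ubb) => y xy eq_xy.
apply: oQ.1 Qx; rewrite /step -eq_xy; apply: lsup_subset => //.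
exact: active_ubound.
Qed.

Definition approximants f : set (cmap X L) :=
  [set g | exists2 p, way_steps f p & forall x, g x = step f p x].

Lemma approximants_directed f : directed (approximants f).
Proof.
split.
  have [|g gE] := @step_continuous f [::]; first by [].
  by exists g, [::].
move=> g1 g2 [p1 fp1 g1E] [p2 fp2 g2E].
have fp : way_steps f (p1 ++ p2).
  by move=> V a; rewrite mem_cat => /orP[/fp1|/fp2].
have [g gE] := step_continuous fp.
exists g; split; first by exists (p1 ++ p2).
  apply/cmap_leP => x; rewrite g1E gE; apply: lsup_subset => //.
    move=> a /activeP[V Vp Vx]; apply/activeP; exists V => //.
    by rewrite mem_cat Vp.
  exact: active_ubound.
apply/cmap_leP => x; rewrite g2E gE; apply: lsup_subset => //.
  move=> a /activeP[V Vp Vx]; apply/activeP; exists V => //.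
  by rewrite mem_cat Vp orbT.
exact: active_ubound.
Qed.

(** A single pair [(V, a)] with [x] in [V] already gives a step function that
    exceeds [a] at [x], and [f x] is the supremum of the [a] way below it. *)
Lemma approximants_supremum f : core_compact X -> supremums (approximants f) f.
Proof.
move=> ccX; split=> [g [p fp gE]|k ubk]; apply/cmap_leP => x.
  by rewrite gE; apply: lsup_le => //; exact: active_ubound.
apply: (contL.2 (f x)).2.2 => a ax.
have [V [Vf Vx]] :=
  core_compact_nbhs ccX (ax : val (preimage_opens f (way_above a)) x).
have fp : way_steps f [:: (V, a)] by move=> W b /[!inE] /eqP[-> ->].
have [g gE] := step_continuous fp.
have /cmap_leP/(_ x) : g <= k by apply: ubk; exists [:: (V, a)].
apply: le_trans; rewrite gE; apply: lsup_ubound => //.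
  exact: active_ubound.
by apply/activeP; exists V; rewrite // mem_head.
Qed.

End StepFunctions.

Lemma near_isbell (X : topologicalType) (d : Order.disp_t) (L : porderType d)
    (f : cmap X L) (H : set (opens X)) (V : opens (scott L)) :
  scott_open H -> H (preimage_opens f V) ->
  \forall h \near (f : isbell X L), H (preimage_opens (h : cmap X L) V).
Proof.
move=> oH Hf; apply: (@open_nbhs_nbhs (isbell X L) f (isbell_subbasic H V)).
by split=> //; exact: isbell_subbasic_open.
Qed.

Section ScottIsbell.
Context {X : topologicalType} {d : Order.disp_t} {L : porderType d}.
Hypotheses (contL : continuous_dcpo L) (LL : L_dcpo L).
Hypotheses (ccX : core_compact X) (rwX : property_RW X).
Hypothesis pointedL : exists b : L, forall x, b <= x.

Definition inter_on n (V : 'I_n -> opens X) (I : {set 'I_n}) : set X :=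
  [set x | forall i, i \in I -> val (V i) x].

Lemma property_RW_on n (V U : 'I_n -> opens X) (I : {set 'I_n}) :
  (forall i, way_below (V i) (U i)) -> I != finset.set0 ->
  inter_on V I !=set0 ->
  exists F, [/\ finite_set F, decomposition F (inter_on V I) &
                relatively_maximal F (inter_on V I) (inter_on U I)].
Proof.
move=> VU I0.
have interE (T : 'I_n -> opens X) :
    inter_on T I = \bigcap_i val (T (enum_val (A := mem I) i)).
  apply/seteqP; split=> x Tx i; first by move=> _; exact/Tx/enum_valP.
  by move=> Ii; have := Tx (enum_rank_in Ii i) Logic.I; rewrite enum_rankK_in.
rewrite !interE; apply: rwX => [|i]; last exact: VU.
by rewrite card_gt0.
Qed.

(** The Isbell neighbourhood of [f] imposes two kinds of finitely many
    conditions on [h]: the sets [W i] stay way below [h^-1 (way above (a i))],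
    and, for each index set [I] and each piece [A] of the intersection of the
    [V i], [h] exceeds at one point of [A] an upper bound [b <= f x] of the
    values [a i]. At that point the suprema below [f x] and below [h x] both
    equal the supremum below [b]; since each of them is constant on [A], they
    agree on all of [A]. The least element of [L] takes care of the points with
    no active value. *)
Lemma near_step_le f p : way_steps contL f p ->
  \forall h \near (f : isbell X L), forall x, step f p x <= (h : cmap X L) x.
Proof.
move=> fp; pose n := size p.
pose V (i : 'I_n) := (tnth (in_tuple p) i).1.
pose a (i : 'I_n) := (tnth (in_tuple p) i).2.
have Vp i : (V i, a i) \in p by rewrite -surjective_pairing mem_tnth.
have /choice[W VWU] i : exists W, way_below (V i) W /\
    way_below W (preimage_opens f (way_above contL (a i))).
  exact: way_below_interpolation ccX _ _ (fp _ _ (Vp i)).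
have VW i := (VWU i).1; have WU i := (VWU i).2.
pose aI (I : {set 'I_n}) : set L := [set` [seq a i | i in I]].
have /choice[F FP] (I : {set 'I_n}) : exists F, finite_set F /\
    (I != finset.set0 -> inter_on V I !=set0 -> decomposition F (inter_on V I) /\
      relatively_maximal F (inter_on V I) (inter_on W I)).
  have [I0|I0] := pselect (I != finset.set0 /\ inter_on V I !=set0); last first.
    by exists set0; split=> // I1 V1; case: I0.
  by have [G [? ? ?]] := property_RW_on VW I0.1 I0.2; exists G.
have FF : Filter (nbhs (f : isbell X L)) by exact: nbhs_filter.
have near_W : \forall h \near (f : isbell X L), forall i,
    way_below (W i) (preimage_opens (h : cmap X L) (way_above contL (a i))).
  apply: (filter_forall FF) => i.
  exact: near_isbell (scott_open_way_above ccX (W i)) (WU i).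
have WI_a (g : cmap X L) I :
    (forall i, way_below (W i) (preimage_opens g (way_above contL (a i)))) ->
    forall x, inter_on W I x -> forall c, aI I c -> way_below c (g x).
  move=> gW x Wx c /fintype.imageP[i Ii ->]; have /way_below_le := gW i.
  by rewrite opens_leE => /(_ x (Wx i Ii)).
have WI_const (g : cmap X L) I A x y :
    (forall i, way_below (W i) (preimage_opens g (way_above contL (a i)))) ->
    I != finset.set0 -> inter_on V I !=set0 -> F I A -> A x -> A y ->
    lsup (L := L) (g x) (aI I) = lsup (L := L) (g y) (aI I).
  move=> gW I0 VI0 FA Ax Ay; have [decF maxF] := (FP I).2 I0 VI0.
  pose s z := lsup (L := L) (g z) (aI I).
  apply: (relatively_maximal_constant (s := s) (U := inter_on W I))
    decF maxF FA Ax Ay.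
  - rewrite openE => z Wz; apply: filter_forall => i.
    have [Ii|nIi] := boolP (i \in I); last exact: filterE.
    by apply: filterS (near_opens (Wz i Ii)).
  - move=> z Vz i Ii; have /way_below_le := VW i; rewrite opens_leE; apply.
    exact: Vz.
  - move=> z Wz.
    have [b [bz ubb]] := way_below_finite_ubound contL (WI_a g I gW z Wz).
    exact: (near_lsup contL LL bz ubb).
have near_points : \forall h \near (f : isbell X L), forall I A, F I A ->
    I != finset.set0 -> inter_on V I !=set0 ->
    exists x b, [/\ A x, ubound (aI I) b, b <= f x & b <= (h : cmap X L) x].
  apply: (filter_forall FF) => I; have [/finite_fsetP[G FG] decF] := FP I.
  have nearA A : A \in G -> \forall h \near (f : isbell X L),
      I != finset.set0 -> inter_on V I !=set0 ->
      exists x b, [/\ A x, ubound (aI I) b, b <= f x & b <= (h : cmap X L) x].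
    move=> AG; have [I0|I0] := pselect (I != finset.set0 /\ inter_on V I !=set0);
      last by apply: filterE => h I1 V1; case: I0.
    have [[_ Fne _ FV] _] := decF I0.1 I0.2.
    have FA : F I A by rewrite FG.
    have [_ [x Ax]] := Fne A FA.
    have Vx : inter_on V I x by rewrite -FV; exists A.
    have [|b [bx ubb]] := way_below_finite_ubound contL (WI_a f I WU x _).
      move=> i Ii; have /way_below_le := VW i; rewrite opens_leE; apply; exact: Vx.
    have near_h : \forall h \near (f : isbell X L), way_below b ((h : cmap X L) x).
      by apply: (near_isbell (scott_open_point x) (V := way_above contL b)).
    apply: filterS near_h => h bh _ _; exists x, b.
    by split=> //; exact: way_below_le.
  apply: filterS (filter_bigI FF nearA) => h hG A FA; apply: hG.
  by move: FA; rewrite FG.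
apply: filterS2 near_W near_points => h hW hpts x.
(* At a given point [x], the relevant index set is that of the active values. *)
pose I := [set i : 'I_n | x \in val (V i)]%SET.
have VIx : inter_on V I x by move=> i; rewrite finset.inE => /set_mem.
have aIE : active p x = aI I.
  apply/seteqP; split=> b.
    move=> /activeP[U Up Ux]; apply/fintype.imageP.
    have /tnthP[i iE] : (U, b) \in in_tuple p by [].
    by exists i; rewrite ?inE /V /a -iE //; apply/mem_set.
  move=> /fintype.imageP[i]; rewrite inE => /set_mem Vx ->.
  by apply/activeP; exists (V i).
rewrite /step aIE.
have [I0|I0] := eqVneq I finset.set0.
  have [bot botP] := pointedL; apply: le_trans (botP _).
  by apply: lsup_least => // b; rewrite I0 => /fintype.imageP[i]; rewrite inE.
have VI0 : inter_on V I !=set0 by exists x.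
have [_ _ _ FV] := ((FP I).2 I0 VI0).1.
have [A FA Ax] : (\bigcup_(A in F I) A) x by rewrite FV.
have [y [b [Ay ubb bf bh]]] := hpts I A FA I0 VI0.
rewrite (WI_const f I A x y) // -(lsup_up LL ubb bf) (lsup_up LL ubb bh).
rewrite -(WI_const h I A x y) //; apply: lsup_le => // c cI.
apply/way_below_le/(WI_a h I hW) => // i Ii.
have /way_below_le := VW i; rewrite opens_leE; apply; exact: VIx.
Qed.

Lemma scott_subset_isbell :
  scott_topology (cmap X L) `<=` isbell_topology X L.
Proof.
move=> O oO; suff : @open (isbell X L) O by [].
rewrite openE => f Of.
have [g [[p fp gE] Og]] := oO.2 _ _ (approximants_directed contL LL f)
  (approximants_supremum contL LL f ccX) Of.
apply: filterS (near_step_le fp) => h ph; apply: oO.1 Og.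
by apply/cmap_leP => x; rewrite gE.
Qed.

End ScottIsbell.

(** * Families without lower bounds *)

Section Separating.
Context {d : Order.disp_t} {L : porderType d}.
Implicit Types (N M S T : set L) (c l m t : L).

Definition bounded_below N T := exists2 c, N c & lbound T c.

Definition pointwise_sup (Y : Type) (D : set (Y -> L)) (s : Y -> L) :=
  forall y, supremums [set h y | h in D] (s y).

Definition pointwise_directed (Y : Type) (D : set (Y -> L)) :=
  D !=set0 /\ forall g h, D g -> D h ->
    exists k, [/\ D k, forall y, g y <= k y & forall y, h y <= k y].

(** [W] has the properties of a Scott-open set of functions, except that its
    inaccessibility only concerns directed sets with an [N]-valued member; and
    membership of the constant function [m] in [W] cannot be ensured by finitely
    many of its values, even among [M]-valued functions. Two sets [N] and [M]
    are needed because lower bounds are excluded from [N] only, whereas the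
    functions that defeat a finite set of coordinates must be realised by
    continuous maps, which requires values in a smaller set [M]. *)
Definition separates N M (Y : choiceType) (m : L) (W : set (Y -> L)) :=
  [/\ M m /\ W (fun=> m),
      forall g h, (forall y, g y <= h y) -> W g -> W h,
      forall D s, pointwise_directed D -> pointwise_sup D s ->
        (exists2 h, D h & forall y, N (h y)) -> W s -> D `&` W !=set0 &
      forall F : seq Y, exists e : Y -> L,
        [/\ forall y, M (e y), forall y, y \in F -> e y = m & ~ W e]].

Definition separating N M :=
  exists (Y : choiceType) (m : L) (W : set (Y -> L)), separates N M m W.

(** The function [e k] takes the value [t] on the first [k] integers and [l]
    from [k] on. An [N]-valued function lies below at most one of the [e k],
    as its value at a point where two of them differ would be a lower bound of
    [t] and [l]. A directed set of functions that lie below some [e k] thus lies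
    below a single one, and so does its supremum. *)
Lemma separating_pair N M t l : M `<=` N -> M t -> M l ->
  ~ bounded_below N [set t; l] -> separating N M.
Proof.
move=> MN Mt Ml nb_tl.
have tlF c : N c -> c <= t -> c <= l -> False.
  by move=> Nc ct cl; apply: nb_tl; exists c => // _ [->|->].
pose e k (n : nat) := if (n < k)%N then t else l.
exists nat, t, [set h | forall k, ~ forall n, h n <= e k n]; split.
- split=> // k /(_ k); rewrite /e ltnn; exact: tlF (MN t Mt) (lexx t).
- by move=> g h gh Wg k hk; apply: (Wg k) => n; exact: le_trans (hk n).
- move=> D s dirD supD [h0 Dh0 Nh0] Ws; apply: contrapT => DW.
  have Dle h : D h -> exists k, forall n, h n <= e k n.
    move=> Dh; apply: contrapT => nle; apply: DW; exists h; split=> // k hk.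
    by apply: nle; exists k.
  have [k0 h0k0] := Dle h0 Dh0.
  apply: (Ws k0) => n; apply: (supD n).2 => _ [h Dh <-].
  have [k [Dk hk h0k]] := dirD.2 _ _ Dh Dh0.
  have [k1 kk1] := Dle k Dk.
  suff eqk : k1 = k0 by apply: le_trans (hk n) _; rewrite -eqk.
  have h0k1 i : h0 i <= e k1 i := le_trans (h0k i) (kk1 i).
  apply/eqP; rewrite eqn_leq; apply/andP; split; rewrite leqNgt; apply/negP => lt_k.
    have := h0k0 k0; have := h0k1 k0; rewrite /e ltnn lt_k.
    exact: tlF (Nh0 k0).
  by have := h0k1 k1; have := h0k0 k1; rewrite /e ltnn lt_k; exact: tlF (Nh0 k1).
- move=> F; pose k := (\max_(i <- F) i).+1%N.
  exists (e k); split=> [n|n nF|].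
  + by rewrite /e; case: ifP.
  + by rewrite /e ltnS (leq_bigmax_seq (F := id)).
  + by move/(_ k); apply.
Qed.

Section Chain.
Variables (I : Type) (lt : I -> I -> Prop) (t : I -> L).
Hypothesis lt_wf : well_founded lt.
Hypothesis lt_trans : forall i j k, lt i j -> lt j k -> lt i k.
Hypothesis lt_total : forall i j, lt i j \/ i = j \/ lt j i.

Lemma wf_minimal (Q : I -> Prop) : (exists i, Q i) ->
  exists2 i, Q i & forall j, lt j i -> ~ Q j.
Proof.
move=> [i Qi]; apply: contrapT => nmin.
elim/(well_founded_ind lt_wf) : i Qi => i IHi Qi.
by apply: nmin; exists i => // j ji Qj; exact: IHi ji Qj.
Qed.

Definition agree_below i (x y : I -> Prop) := forall j, lt j i -> x j = y j.

(** [high i c] is Scott open in [c] and increases with [i], and every [c] that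
    is not a lower bound of the family [t] is high at all [i] after some [j]. *)
Definition high i c := exists2 j, lt j i & ~ c <= t j.

(** As a condition on [h] this is open, since it involves two values only. *)
Definition crowded i (h : (I -> Prop) -> L) := exists x y,
  [/\ x <> y, agree_below i x y, high i (h x) & high i (h y)].

(** If [h] is not crowded at [i], then points [y] with [h y] high at [i] are
    determined by their restriction below [i]. Define [x] by recursion: [x]
    disagrees at [i] with the only such point that agrees with [x] below [i].
    Then [h x] is not high at any [i] where [h] is not crowded. *)
Lemma diagonal (h : (I -> Prop) -> L) :
  exists x, forall i, ~ crowded i h -> ~ high i (h x).
Proof.
(* [x i] is the negation of [y i], for [y] the twin of [x] at [i], if any. *)
pose rec i (x : forall j, lt j i -> Prop) :=
  ~ exists y, [/\ forall j (ji : lt j i), x j ji = y j, high i (h y) & y i].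
pose x := Fix lt_wf (fun=> Prop) rec.
have xE i : x i = ~ exists y, [/\ agree_below i x y, high i (h y) & y i].
  rewrite /x Fix_eq // => j f g fg; rewrite /rec.
  by have -> : f = g by do 2!apply: functional_extensionality_dep => ?.
exists x => i ncrowd xhigh; have := xE i.
have [xi|nxi] := pselect (x i).
  by move: (xi) => /[swap] -> []; exists x.
move=> xiE; have : exists y, [/\ agree_below i x y, high i (h y) & y i].
  by apply: contrapT => ny; apply: nxi; rewrite xiE.
move=> [y [xy yhigh yi]]; apply: ncrowd; exists x, y; split=> // eq_xy.
by apply: nxi; rewrite eq_xy.
Qed.

Lemma highS i c c' : c <= c' -> high i c -> high i c'.
Proof. by move=> cc' [j ji ct]; exists j => // /(le_trans cc'). Qed.

Lemma crowdedS i g h : (forall y, g y <= h y) -> crowded i g -> crowded i h.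
Proof.
move=> gh [x [y [xy agr hx hy]]].
by exists x, y; split=> //; [exact: highS hx|exact: highS hy].
Qed.

Section NoMax.
Hypothesis no_max : forall i, exists j, lt i j.

Lemma strict_ubound (T : eqType) (f : T -> I) (s : seq T) i0 :
  exists k, lt i0 k /\ forall x, x \in s -> lt (f x) k.
Proof.
elim: s => [|x s [k [i0k sk]]]; first by have [k i0k] := no_max i0; exists k.
have [j fxj] := no_max (f x).
have [kj|jk] := pselect (lt k j).
  exists j; split=> [|y]; first exact: lt_trans kj.
  by rewrite inE => /predU1P[->//|/sk yk]; exact: lt_trans kj.
exists k; split=> // y; rewrite inE => /predU1P[->|/sk//].
by case: (lt_total k j) => [//|[->//|]]; exact: lt_trans.
Qed.

(** Distinct members of a finite family differ at some index, and finitely many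
    indices are bounded as there is no last one. *)
Lemma separate_finite (F : seq (I -> Prop)) i0 : exists i, lt i0 i /\
  forall x y, x \in F -> y \in F -> agree_below i x y -> x = y.
Proof.
have /choice[f fP] (q : (I -> Prop) * (I -> Prop)) :
    exists i, q.1 <> q.2 -> q.1 i <> q.2 i.
  have [[i qi]|q12] := pselect (exists i, q.1 i <> q.2 i); first by exists i.
  exists i0 => -[]; apply/funext => i.
  by apply: contrapT => qi; apply: q12; exists i.
have [k [i0k kP]] := strict_ubound f [seq (x, y) | x <- F, y <- F] i0.
exists k; split=> // x y xF yF agr; apply: contrapT => xy.
by apply: (fP (x, y) xy); apply: agr; apply: kP; apply/allpairsP; exists (x, y).
Qed.

End NoMax.

(** The set [W] consists of the functions that are crowded at all [i] beyond
    some [i1]. It is not determined by finitely many values: for [i] large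
    enough to tell the points of [F] apart, the function equal to [m] on [F] and
    to a lower bound of the [t j], [j < i], elsewhere is high at [i] on [F] only,
    hence not crowded at [i]. It is inaccessible by directed suprema although it
    is an infinite intersection of open sets: [diagonal] shows that an
    [N]-valued function is crowded from some [i0] on, and well-foundedness
    deals with the indices before [i0]. *)
Lemma separating_chain N M : M `<=` N -> M !=set0 ->
  ~ bounded_below N (range t) ->
  (forall i, bounded_below M [set t j | j in [set j | ~ lt i j]]) ->
  separating N M.
Proof.
move=> MN [m Mm] nbN bM.
have not_low c : N c -> exists i, ~ c <= t i.
  move=> Nc; apply: contrapT => low; apply: nbN; exists c => // _ [i _ <-].
  by apply: contrapT => cti; apply: low; exists i.
have no_max i : exists j, lt i j.
  have [c Mc lowc] := bM i; have [j ctj] := not_low c (MN c Mc).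
  by exists j; apply: contrapT => nij; apply: ctj; apply: lowc; exists j.
have lt_irr i : ~ lt i i.
  by elim/(well_founded_ind lt_wf) : i => i IHi ii; exact: (IHi i ii ii).
have [i1 mi1] := not_low m (MN m Mm).
exists (I -> Prop), m, [set h | forall i, lt i1 i -> crowded i h]; split.
- split=> // i i1i; exists (fun=> False), (fun j => j = i); split.
  + by move=> /(congr1 (@^~ i)) /= ii; rewrite ii.
  + move=> j ji; apply/propext; split=> // eqji.
    by apply: lt_irr (i) _; rewrite -{1}eqji.
  + by exists i1.
  + by exists i1.
- by move=> g h gh Wg i i1i; apply: crowdedS gh _; exact: Wg.
- move=> D s dirD supD [h0 Dh0 Nh0] Ws; apply: contrapT => DW.
  pose bad h i := lt i1 i /\ ~ crowded i h.
  have badP h : D h -> exists i, bad h i.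
    move=> Dh; apply: contrapT => nbad; apply: DW; exists h; split=> // i i1i.
    by apply: contrapT => ncrowd; apply: nbad; exists i.
  have badS g h i : (forall y, g y <= h y) -> bad h i -> bad g i.
    by move=> gh [i1i ncrowd]; split=> //; apply: contra_not ncrowd; exact: crowdedS.
  have [i0 bad0] : exists i0, forall i, bad h0 i -> ~ lt i0 i.
    have [x xP] := diagonal h0; have [i0 xi0] := not_low _ (Nh0 x).
    by exists i0 => i [_ /xP nhigh] i0i; apply: nhigh; exists i0.
  (* [i] is least such that every member of [D] is bad somewhere up to [i]. *)
  have [|i iP imin] :=
      @wf_minimal (fun i => forall h, D h -> exists2 j, bad h j & ~ lt i j).
    exists i0 => h Dh; have [k [Dk hk h0k]] := dirD.2 _ _ Dh Dh0.
    have [j kj] := badP k Dk; exists j; first exact: badS hk kj.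
    by apply: bad0; exact: badS h0k kj.
  have i1i : lt i1 i.
    have [j [i1j _] nij] := iP h0 Dh0.
    by case: (lt_total i j) => [//|[->//|ji]]; exact: lt_trans i1j ji.
  have [x [y [xy agr [jx jxi sx] [jy jyi sy]]]] := Ws i i1i.
  have above z j : ~ s z <= t j -> exists2 h, D h & ~ h z <= t j.
    move=> sz; apply: contrapT => nD; apply: sz; apply: (supD z).2 => _ [h Dh <-].
    by apply: contrapT => hz; apply: nD; exists h.
  have [hx Dhx hxx] := above x jx sx; have [hy Dhy hyy] := above y jy sy.
  (* Let [j] be the later of [jx] and [jy]. By minimality of [i], some member of
     [D] has no bad index up to [j]; any larger member is bad only beyond [j],
     and at some index not beyond [i], where the pair [x], [y] shows that it is
     crowded once its values at [x] and [y] are large enough. *)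
  have [j [ji jxj jyj]] : exists j, [/\ lt j i, ~ lt j jx & ~ lt j jy].
    case: (lt_total jx jy) => [xy'|[eqxy|yx']]; last 1 first.
    - by exists jx; split=> // /(lt_trans yx')/lt_irr.
    - by exists jy; split=> // /(lt_trans xy')/lt_irr.
    - by exists jy; rewrite eqxy; split.
  have [h1 Dh1 h1bad] : exists2 h, D h & forall k, bad h k -> lt j k.
    apply: contrapT => nD; apply: imin ji _ => h Dh; apply: contrapT => nbad.
    apply: nD; exists h => // k hk; apply: contrapT => jk.
    by apply: nbad; exists k.
  have [h2 [Dh2 hxh2 hyh2]] := dirD.2 _ _ Dhx Dhy.
  have [h3 [Dh3 h2h3 h1h3]] := dirD.2 _ _ Dh2 Dh1.
  have [k h3k nik] := iP h3 Dh3.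
  have jk : lt j k by apply: h1bad; exact: badS h1h3 h3k.
  have before r : ~ lt j r -> lt r k.
    by case: (lt_total j r) => [//|[<-//|rj _]]; exact: lt_trans rj jk.
  apply: h3k.2; exists x, y; split=> //.
  + move=> r rk; apply: agr.
    by case: (lt_total k i) => [ki|[<-//|//]]; exact: lt_trans rk ki.
  + exists jx; first exact: before.
    by move=> h3x; apply: hxx; apply: le_trans h3x; exact: le_trans (h2h3 x).
  + exists jy; first exact: before.
    by move=> h3y; apply: hyy; apply: le_trans h3y; exact: le_trans (h2h3 y).
- move=> F; have [i [i1i Fi]] := separate_finite no_max F i1.
  have [c Mc lowc] := bM i.
  exists (fun x => if x \in F then m else c); split.
  + by move=> x; case: ifP.
  + by move=> x ->.
  + move=> /(_ i i1i) [x [y [xy agr hx hy]]].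
    have inF z : high i (if z \in F then m else c) -> z \in F.
      case: ifP => // _ [j ji []]; apply: lowc; exists j => //= ij.
      exact: lt_irr (lt_trans ij ji).
    by apply: xy; apply: Fi => //; exact: inF.
Qed.

End Chain.

Lemma strict_well_order (T : eqType) : exists lt : T -> T -> Prop,
  [/\ well_founded lt, forall x y z, lt x y -> lt y z -> lt x z &
      forall x y, lt x y \/ x = y \/ lt y x].
Proof.
have [R wo] := well_ordering_principle T.
have min3 (x y z : T) : exists w, [/\ w \in [:: x; y; z], R w x, R w y & R w z].
  have [|w [[wA wle] _]] := wo (mem [:: x; y; z]).
    by exists x; exact: mem_head.
  by exists w; split=> //; apply: wle; rewrite !inE eqxx ?orbT.
have Rxx x : R x x by have [w []] := min3 x x x; rewrite !inE !orbb => /eqP->.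
have Ranti x y : R x y -> R y x -> x = y.
  move=> xy yx; have [|w [_ uniqw]] := wo (mem [:: x; y]).
    by exists x; exact: mem_head.
  by rewrite -(uniqw x) ?(uniqw y) //; split; rewrite ?inE ?eqxx ?orbT // => v;
    rewrite !inE => /orP[] /eqP->.
have Rtotal x y : R x y \/ R y x.
  by have [w []] := min3 x y y; rewrite !inE orbb => /orP[] /eqP->; [left|right].
exists (fun x y => R x y /\ x <> y); split.
- move=> x; apply: contrapT => nacc.
  have [|w [[/asboolP nw wle] _]] :=
      wo (fun z => `[< ~ Acc (fun x y => R x y /\ x <> y) z >]).
    by exists x; apply/asboolP.
  apply: nw; constructor=> y [yw neq]; apply: contrapT => ny; apply: neq.
  by apply: Ranti => //; apply: wle; apply/asboolP.
- move=> x y z [xy nxy] [yz nyz].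
  have [w []] := min3 x y z; rewrite !inE => /or3P[] /eqP-> //.
  + move=> _ _ xz; split=> // eqxz; apply: nxy; apply: Ranti => //.
    by rewrite eqxz.
  + by move=> yx _ _; case: nxy; exact: Ranti.
  + by move=> _ zy _; case: nyz; exact: Ranti.
- move=> x y; have [->|/eqP nxy] := eqVneq x y; first by right; left.
  have [xy|yx] := Rtotal x y; [by left|right; right; split=> // eqyx].
  by apply: nxy.
Qed.

(** Well-order [L], and let [seg s] be the initial segment of [T] that ends with
    [s]. If some [seg s] has no lower bound at some level [q], take the least
    such [s]. At the next level [q'], either the strict segment before [s] has a
    lower bound [l], and then [s] and [l] have no common lower bound at level
    [q]; or it has none, whereas its own initial segments have lower bounds at
    all levels, by minimality of [s]. If every [seg s] has lower bounds at all
    levels, then [T] itself is such a family. *)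
Lemma separating_levels (Q : Type) (R : Q -> Q -> Prop) (N M : Q -> set L)
    T (q0 : Q) :
  (forall q, exists q', R q q') ->
  (forall q q', R q q' -> M q' `<=` M q) ->
  (forall q, M q `<=` N q) ->
  (forall q c t, N q c -> T t -> c <= t -> M q c) ->
  (forall q, T `<=` M q) -> T !=set0 ->
  (forall q, ~ bounded_below (M q) T) ->
  exists q q', R q q' /\ separating (N q) (M q').
Proof.
move=> nextR subM MN NM TM [m Tm] nbT.
have MN' q q' : R q q' -> M q' `<=` N q.
  by move=> qq'; apply: subset_trans (MN q); exact: subM.
have [lt [lt_wf lt_trans lt_total]] := strict_well_order L.
pose seg s := [set u | T u /\ ~ lt s u].
have sep q q' S : R q q' -> S `<=` T -> ~ bounded_below (M q) S ->
    (forall s, S s -> bounded_below (M q') (seg s)) -> separating (N q) (M q').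
  move=> qq' ST nbS bseg.
  pose I := {s | S s}.
  apply: (@separating_chain I (fun i j => lt (sval i) (sval j)) sval).
  - move=> i; move: {2}(sval i) (erefl (sval i)) => s.
    elim/(well_founded_ind lt_wf) : s i => s IHs i is_; constructor=> j ji.
    by apply: IHs (erefl (sval j)); rewrite -is_.
  - by move=> i j k; exact: lt_trans.
  - move=> [i Si] [j Sj] /=.
    have [|[eqij|]] := lt_total i j; [by left| |by right; right].
    right; left; subst j; congr exist; exact: Prop_irrelevance.
  - exact: MN'.
  - by exists m; exact: TM Tm.
  - move=> [c Nc lowc]; apply: nbS.
    have {}lowc : lbound S c by move=> s Ss; apply: lowc; exists (exist _ s Ss).
    have [[s Ss]|S0] := pselect (S !=set0).
      by exists c => //; apply: NM Nc (ST s Ss) (lowc s Ss).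
    by exists m => [|s Ss]; [exact: TM Tm|case: S0; exists s].
  - move=> [s Ss]; have [c Mc lowc] := bseg s Ss.
    exists c => // _ [[u Su] /= su <-].
    by apply: lowc; split=> //; exact: ST.
have [[q [s [Ts nbs]]]|bseg] :=
    pselect (exists q s, T s /\ ~ bounded_below (M q) (seg s)).
  have [|{}s [{}q [{}Ts {}nbs]] smin] :=
    @wf_minimal _ lt lt_wf (fun s => exists q, T s /\ ~ bounded_below (M q) (seg s)).
    by exists s, q.
  have [q' qq'] := nextR q; have [q'' q'q''] := nextR q'.
  pose S := [set u | T u /\ lt u s].
  have [[l Ml lowl]|nbS] := pselect (bounded_below (M q') S).
    exists q, q'; split=> //; apply: (separating_pair (t := s) (l := l)) => //.
    - exact: MN'.
    - exact: TM.
    - move=> [c Nc lowc]; apply: nbs.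
      have cs : c <= s by apply: lowc; left.
      exists c => [|u [Tu nsu]]; first exact: NM Nc Ts cs.
      have [us|[->|//]] := lt_total u s; last by [].
      by apply: le_trans (lowl u _); [apply: lowc; right|].
  exists q', q''; split=> //; apply: (sep _ _ S) => // [u []//|u [Tu us]].
  by apply: contrapT => nbu; apply: (smin u us); exists q''.
have [q1 q0q1] := nextR q0.
exists q0, q1; split=> //; apply: (sep _ _ T) => // s Ts.
by apply: contrapT => nbs; apply: bseg; exists q1, s.
Qed.

End Separating.

(** * Alexandrov spaces *)

Section UpSets.
Context {P : Type} (r : P -> P -> Prop).

Definition up_closed (U : set P) := forall x y, r x y -> U x -> U y.

Lemma up_closedT : up_closed setT. Proof. by []. Qed.

Lemma up_closedI : setI_closed up_closed.
Proof. by move=> U V Uup Vup x y xy [Ux Vx]; split; [exact: Uup Ux|exact: Vup Vx]. Qed.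

Lemma up_closed_bigcup (I : Type) (f : I -> set P) :
  (forall i, up_closed (f i)) -> up_closed (\bigcup_i f i).
Proof. by move=> fup x y xy [i _ fx]; exists i => //; exact: fup fx. Qed.

End UpSets.

(** When [r] is a preorder, the compact open sets are generated by finite sets
    and the continuous maps to [L] are the monotone ones. *)
Definition alexandrov (P : choiceType) (r : P -> P -> Prop) : Type := P.

HB.instance Definition _ (P : choiceType) r := Choice.on (@alexandrov P r).
HB.instance Definition _ (P : choiceType) (r : P -> P -> Prop) :=
  isOpenTopological.Build (alexandrov r)
    (@up_closedT P r) (@up_closedI P r) (@up_closed_bigcup P r).

Section Alexandrov.
Context {P : choiceType} (r : P -> P -> Prop).
Hypotheses (r_refl : forall x, r x x)
  (r_trans : forall x y z, r x y -> r y z -> r x z).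
Local Notation X := (alexandrov r).

Lemma alexandrov_openE (U : set X) : open U <-> up_closed r U.
Proof. by []. Qed.

Definition up_of (F : seq X) : set X := [set y | exists2 x, x \in F & r x y].

Lemma up_of_open F : open (up_of F).
Proof.
by apply/alexandrov_openE => x y xy [z Fz zx]; exists z => //; exact: r_trans xy.
Qed.

Lemma up_of_sub F (U : opens X) : [set` F] `<=` val U -> up_of F `<=` val U.
Proof.
move=> FU y [x Fx xy].
exact: (alexandrov_openE _).1 (opens_open U) _ _ xy (FU _ Fx).
Qed.

Definition up_opens F : opens X := mkopens (@up_of_open F).

Definition finite_ups (U : opens X) : set (opens X) :=
  [set V | exists2 F : seq X, [set` F] `<=` val U & V = up_opens F].

Lemma finite_ups_directed U : directed (finite_ups U).
Proof.
split; first by exists (up_opens [::]), [::].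
move=> _ _ [F FU ->] [G GU ->]; exists (up_opens (F ++ G)).
split; first by exists (F ++ G) => // x /=; rewrite mem_cat => /orP[/FU|/GU].
  by rewrite opens_leE => y [x Fx xy]; exists x => //; rewrite mem_cat Fx.
by rewrite opens_leE => y [x Fx xy]; exists x => //; rewrite mem_cat Fx orbT.
Qed.

Lemma finite_ups_supremum U : supremums (finite_ups U) U.
Proof.
apply: opens_supremums; apply/seteqP.
split=> [x Ux|x [_ [F FU ->] /= /(up_of_sub FU)//]].
exists (up_opens [:: x]).
  by exists [:: x] => // y /=; rewrite inE => /eqP->.
by exists x => //; rewrite mem_head.
Qed.

Lemma finite_ups_way_below U V : finite_ups U V -> way_below V U.
Proof.
move=> [F FU ->] D W [[W0 DW0] dirD] supD UW.
have [V' DV' FV'] : exists2 V', D V' & [set` F] `<=` val V'.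
  elim: F FU => [|x F IHF] FU; first by exists W0.
  have [|V1 DV1 FV1] := IHF; first by move=> y Fy; apply: FU; rewrite /= inE Fy orbT.
  have : val W x by move: UW; rewrite opens_leE; apply; apply: FU; exact: mem_head.
  rewrite (opens_supremumsE supD) => -[V2 DV2 V2x].
  have [V3 [DV3 V13 V23]] := dirD _ _ DV1 DV2; exists V3 => // y /=.
  rewrite inE => /predU1P[->|/FV1]; first by move: V23; rewrite opens_leE; apply.
  by move: V13; rewrite opens_leE; apply.
by exists V' => //; rewrite opens_leE; exact: up_of_sub.
Qed.

(** The up-sets of finite sets form a basis of compact open sets. *)
Lemma alexandrov_core_compact : core_compact X.
Proof.
apply: continuous_dcpo_of_basis => [|U]; first exact: opens_dcpo.
exists (finite_ups U); split; [exact: finite_ups_directed| |exact: finite_ups_way_below].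
exact: finite_ups_supremum.
Qed.

Lemma alexandrov_way_below (V U : opens X) : way_below V U ->
  exists F : seq X, val V `<=` up_of F.
Proof.
move=> /(_ _ _ (finite_ups_directed U) (finite_ups_supremum U) (lexx U)).
by move=> [_ [F FU ->]]; rewrite opens_leE; exists F.
Qed.

Lemma alexandrov_open_bigcap k (V : 'I_k -> opens X) :
  open (\bigcap_i val (V i)).
Proof.
apply/alexandrov_openE => x y xy Vx i _.
exact: (alexandrov_openE _).1 (opens_open (V i)) _ _ xy (Vx i Logic.I).
Qed.

(** Any two nonempty open sets meet in the greatest element, hence the only
    decomposition of a nonempty open set is the trivial one. *)
Lemma alexandrov_RW_top top : (forall x, r x top) -> RW_space X.
Proof.
move=> topP; split; first exact: alexandrov_core_compact.
have open_top (B : set X) : open B -> B !=set0 -> B top.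
  by move=> /alexandrov_openE Bup [x Bx]; exact: Bup (topP x) Bx.
move=> k V U k_gt0 VU V0; set IV := \bigcap_i val (V i) in V0 *.
have IVU : IV `<=` \bigcap_i val (U i).
  by move=> x Vx i _; have /way_below_le := VU i; rewrite opens_leE; apply; exact: Vx.
exists [set IV]; split; first exact: finite_set1.
- split=> //; [|exact: trivIset1|exact: bigcup_set1].
  by move=> _ ->; split=> //; exact: alexandrov_open_bigcap.
- move=> G [_ Gop trivG GU] B GB [x [Bx Vx]].
  have Bmeets C : G C -> C = B.
    move=> GC; apply: trivG => //; exists top.
    by split; apply: open_top; apply Gop.
  apply/seteqP; split=> [y [By Vy]|y [_ [-> _] Vy]].
    by exists IV => //; split=> //; exists x.
  split=> //; have : (\bigcup_(A in G) A) y by rewrite GU; exact: IVU.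
  by move=> [C GC Cy]; rewrite -(Bmeets C GC).
Qed.

(** In a discrete space the sets way below another one are finite, and
    their decomposition into points is the finest one. *)
Lemma alexandrov_RW_discrete : (forall x y, r x y -> x = y) -> RW_space X.
Proof.
move=> disc; split; first exact: alexandrov_core_compact.
have discO (B : set X) : open B by apply/alexandrov_openE => x y /disc->.
move=> [//|k] V U _ VU V0; set IV := \bigcap_i val (V i) in V0 *.
exists [set [set x] | x in IV]; split.
- apply: finite_image; have [F VF] := alexandrov_way_below (VU ord0).
  apply: sub_finite_set (finite_seq F) => x /(_ ord0 Logic.I)/VF[y Fy /disc yx].
  by rewrite -yx.
- split=> //.
  + by move=> _ [x Vx <-]; split=> //; exists x.
  + by move=> _ _ [x _ <-] [y _ <-] [z [/= -> ->]].
  + apply/seteqP; split=> [y [_ [x Vx <-] ->]//|x Vx].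
    by exists [set x] => //; exists x.
- move=> G _ B GB _; apply/seteqP; split=> [x [Bx Vx]|x].
    by exists [set x] => //; split; [exists x|exists x].
  by move=> [_ [[y Vy <-] [z [-> Bz]]] ->].
Qed.

Context {d : Order.disp_t} {L : porderType d}.

Lemma alexandrov_cmap (f : X -> L) : (forall x y, r x y -> f x <= f y) ->
  exists g : cmap X L, forall x, g x = f x.
Proof.
move=> fmono; apply: cmap_of => Q [Qup _]; apply/alexandrov_openE => x y xy.
exact: Qup (fmono x y xy).
Qed.

Lemma scott_open_not_le (c : L) : scott_open [set x : L | ~ x <= c].
Proof.
split=> [x y xy|D s _ supD sc]; first by apply: contra_not; exact: le_trans.
apply: contrapT => nD; apply: sc; apply: supD.2 => x Dx.
by apply: contrapT => xc; apply: nD; exists x.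
Qed.

Lemma alexandrov_cmap_mono (f : cmap X L) x y : r x y -> (f x : L) <= f y.
Proof.
move=> xy; apply: contrapT => nle.
have /alexandrov_openE := scott_open_preimage f (scott_open_not_le (f y)).
by move=> /(_ x y xy nle); apply; exact: lexx.
Qed.

(** A Scott-open family of open sets that contains [f^-1 (V)] contains the
    up-set of a finite set of points of [f^-1 (V)]. *)
Lemma alexandrov_isbell_open (O : set (cmap X L)) (f : cmap X L) :
  isbell_topology X L O -> O f ->
  exists F : seq X, forall h : cmap X L,
    (forall x, x \in F -> (f x : L) <= h x) -> O h.
Proof.
move=> oO; move: O oO f.
apply: isbell_open_ind =>
  [f _|A B IHA IHB f [Af Bf]|I A IHA f [i _ Aif]|H V oH f Hf].
- by exists [::].
- have [[F FA] [G GB]] := (IHA f Af, IHB f Bf); exists (F ++ G) => h hFG.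
  by split; [apply: FA => x xF|apply: GB => x xG];
    apply: hFG; rewrite mem_cat ?xF ?xG ?orbT.
- by have [F FA] := IHA i f Aif; exists F => h /FA; exists i.
- have [V' [[F FU ->] HF]] :=
    oH.2 _ _ (finite_ups_directed _) (finite_ups_supremum _) Hf.
  exists F => h Fh; apply: oH.1 HF; rewrite opens_leE; apply: up_of_sub => x Fx.
  exact: (opens_open V).1 (Fh x Fx) (FU x Fx).
Qed.

End Alexandrov.

(** * Coincidence yields a least element *)

Section LeastElement.
Context {d : Order.disp_t} {L : porderType d}.
Hypothesis contL : continuous_dcpo L.

Section Transfer.
Context {P : choiceType} (r : P -> P -> Prop).
Hypotheses (r_refl : forall x, r x x)
  (r_trans : forall x y z, r x y -> r y z -> r x z).
Local Notation X := (alexandrov r).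

(** The maps in [C] whose restriction along [iota] is in [W] form a Scott-open
    set, which is not Isbell open: outside the image of [iota] the extensions of
    all [M]-valued functions agree with [base], so that only the finitely many
    constrained values in that image matter. *)
Lemma separates_isbell_neq_scott (N M : set L) (Y : choiceType)
    (m : L) (W : set (Y -> L))
    (iota : Y -> X) (C : set (cmap X L)) (base : X -> L) :
  separates N M m W -> injective iota -> scott_open C ->
  (forall h, C h -> forall y, N (h (iota y))) ->
  (forall e, (forall y, M (e y)) -> exists g : cmap X L,
     [/\ C g, forall y, g (iota y) = e y &
         forall x, (forall y, x <> iota y) -> g x = base x]) ->
  isbell_topology X L = scott_topology (cmap X L) -> False.
Proof.
move=> [[Mm Wm] Wup Wacc Wfin] iota_inj [Cup Cacc] CN extend isbellE.
pose O := [set h : cmap X L | C h /\ W (fun y => h (iota y))].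
have oO : scott_open O.
  split=> [g h gh [Cg Wg]|D s dirD supD [Cs Ws]].
    split; first exact: Cup gh Cg.
    by apply: Wup Wg => y; move/cmap_leP : gh; apply.
  have [h0 [Dh0 Ch0]] := Cacc D s dirD supD Cs.
  pose DY : set (Y -> L) := [set (fun y => h (iota y)) | h in D].
  have dirDY : pointwise_directed DY.
    split; first by exists (fun y => h0 (iota y)), h0.
    move=> _ _ [g Dg <-] [h Dh <-].
    have [k [Dk /cmap_leP gk /cmap_leP hk]] := dirD.2 _ _ Dg Dh.
    by exists (fun y => k (iota y)); split=> //; exists k.
  have supDY : pointwise_sup DY (fun y => s (iota y)).
    move=> y; have := cmap_supremums_at contL.1 (iota y) dirD supD.
    congr (supremums _ _); apply/seteqP; split=> [_ [h Dh <-]|_ [_ [h Dh <-] <-]].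
      by exists (fun y => h (iota y)) => //; exists h.
    by exists h.
  have NDY : exists2 h, DY h & forall y, N (h y).
    by exists (fun y => h0 (iota y)); [exists h0|exact: CN].
  have [_ [[h Dh <-] Wh]] := Wacc _ _ dirDY supDY NDY Ws.
  have [k [Dk hk h0k]] := dirD.2 _ _ Dh Dh0.
  exists k; split=> //; split; first exact: Cup h0k Ch0.
  by apply: Wup Wh => y; move/cmap_leP : hk; apply.
have [f [Cf fm fbase]] := extend (fun=> m) (fun=> Mm).
have Of : O f by split=> //; apply: Wup Wm => y; rewrite fm.
have oO' : isbell_topology X L O by rewrite isbellE.
have [F FO] := alexandrov_isbell_open r_refl r_trans oO' Of.
have [G FG] : exists G : seq Y, forall y, iota y \in F -> y \in G.
  elim: F {FO} => [|x F [G FG]]; first by exists [::].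
  have [[y0 ->]|nx] := pselect (exists y, x = iota y).
    by exists (y0 :: G) => y; rewrite !inE => /predU1P[/iota_inj->|/FG->];
      rewrite ?eqxx ?orbT.
  exists G => y; rewrite inE => /predU1P[yx|/FG//].
  by case: nx; exists y.
have [e [Me em nWe]] := Wfin G; have [g [Cg ge gbase]] := extend e Me.
apply: nWe; have [|_] := FO g.
  move=> x Fx; have [[y xE]|nx] := pselect (exists y, x = iota y).
    by rewrite xE fm ge em //; apply: FG; rewrite -xE.
  by rewrite fbase ?gbase // => y xE; apply: nx; exists y.
by apply: Wup => y; rewrite ge.
Qed.

End Transfer.

(** Over a discrete space a single level suffices: all elements of [L] serve
    both as values and as candidate lower bounds. *)
Lemma isbell_scott_pointed : [set: L] !=set0 ->
  (forall X : topologicalType, RW_space X ->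
     isbell_topology X L = scott_topology (cmap X L)) ->
  exists b : L, forall x, b <= x.
Proof.
move=> [x0 _] coincide; apply: contrapT => nobot.
have nb : ~ bounded_below [set: L] setT.
  by move=> [c _ lowc]; apply: nobot; exists c => x; exact: lowc.
have [_ [_ [_ [Y [m [W sepW]]]]]] :
    exists q q' : unit, True /\ separating [set: L] [set: L].
  by apply: (@separating_levels d L unit (fun _ _ => True) (fun=> setT)
    (fun=> setT) setT tt) => //; exists x0.
have eq_refl (y : Y) : y = y by [].
have eq_tr (x y z : Y) : x = y -> y = z -> x = z by move=> ->.
apply: (@separates_isbell_neq_scott Y (fun x y => x = y) eq_refl eq_tr _ _ _ _ _
  id setT (fun=> x0) sepW) => //.
- exact: scott_openT.
- move=> e _; have [x y ->//|g gE] := @alexandrov_cmap Y (fun x y => x = y) d L e.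
  by exists g; split=> // x nx; case: (nx x).
- by apply: coincide; apply: alexandrov_RW_discrete.
Qed.

End LeastElement.

(** * Coincidence yields relative suprema *)

(** The values at [BLeft] and [BRight] are lower bounds of all the others and
    encode the two elements whose upper bounds are studied; [BTop] keeps the
    values below a given element and makes the space irreducible. *)
Inductive bipointed (Y : Type) : Type :=
  BLeft | BRight | BTop | BMid of Y.
Arguments BLeft {Y}.
Arguments BRight {Y}.
Arguments BTop {Y}.

HB.instance Definition _ (Y : Type) := gen_eqMixin (bipointed Y).
HB.instance Definition _ (Y : Type) := gen_choiceMixin (bipointed Y).

Definition bipointed_le (Y : Type) (p q : bipointed Y) : Prop :=
  match p, q with
  | _, BTop => True
  | BLeft, BMid _ => True
  | BRight, BMid _ => True
  | _, _ => p = q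
  end.

Section LocalSups.
Context {d : Order.disp_t} {L : porderType d}.
Hypothesis contL : continuous_dcpo L.

Lemma bipointed_le_refl (Y : Type) (p : bipointed Y) : bipointed_le p p.
Proof. by case: p. Qed.

Lemma bipointed_le_trans (Y : Type) (p q s : bipointed Y) :
  bipointed_le p q -> bipointed_le q s -> bipointed_le p s.
Proof. by case: p => [|||y]; case: q => [|||y']; case: s => [|||y''] //= -> . Qed.

Definition upper_bounds_below (z : L) (q : L * L) : set L :=
  [set c | [/\ q.1 <= c, q.2 <= c & c <= z]].

Definition way_below2 (q q' : L * L) :=
  way_below q.1 q'.1 /\ way_below q.2 q'.2.

Lemma way_below2_interpolation q r : way_below2 q r ->
  exists q', way_below2 q q' /\ way_below2 q' r.
Proof.
move=> [/(way_below_interpolation contL)[u [qu ur]]].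
move=> /(way_below_interpolation contL)[v [qv vr]].
by exists (u, v).
Qed.

Lemma way_below2_below r : exists q, way_below2 q r.
Proof.
have [[u ur] _] := (contL.2 r.1).1; have [[v vr] _] := (contL.2 r.2).1.
by exists (u, v).
Qed.

(** The elements below all bounds of some [r << (a, b)] form a directed set, by
    interpolation; its supremum exceeds every [u << a] and every [v << b], and
    lies below all bounds of [a] and [b] under [z]. *)
Lemma local_sup_of_lower_bounds z a b : a <= z -> b <= z ->
  (forall q r, way_below2 q r -> way_below2 r (a, b) ->
     bounded_below (upper_bounds_below z q) (upper_bounds_below z r)) ->
  exists c, local_sup z [set a; b] c.
Proof.
move=> az bz bounded.
pose UB := upper_bounds_below z.
have UBz r : way_below2 r (a, b) -> UB r z.
  by move=> [/way_below_le ra /way_below_le rb]; split=> //;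
    [exact: le_trans az|exact: le_trans bz].
pose C := [set c | exists2 r, way_below2 r (a, b) & lbound (UB r) c].
have lowC q r : way_below2 q r -> way_below2 r (a, b) ->
    exists c, [/\ C c, UB q c & lbound (UB r) c].
  move=> qr rab; have [c UBc lowc] := bounded q r qr rab.
  by exists c; split=> //; exists r.
have dirC : directed C.
  split.
    have [r rab] := way_below2_below (a, b); have [q qr] := way_below2_below r.
    by have [c [Cc _ _]] := lowC q r qr rab; exists c.
  move=> c1 c2 [r1 [r1a r1b] low1] [r2 [r2a r2b] low2].
  have [u [ua r1u r2u]] := way_below_upper2 contL r1a r2a.
  have [v [vb r1v r2v]] := way_below_upper2 contL r1b r2b.
  have [r [r3r rab]] := way_below2_interpolation (conj ua vb : way_below2 (u, v) (a, b)).
  have [c [Cc [uc vc cz] _]] := lowC _ _ r3r rab.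
  exists c; split=> //; [apply: low1|apply: low2]; split=> //;
    by [exact: le_trans uc|exact: le_trans vc].
have [s supC] := contL.1 C dirC; exists s.
have C_le c w : C c -> w <= z -> a <= w -> b <= w -> c <= w.
  move=> [r [ra rb] low] wz aw bw; apply: low; split=> //.
    exact: le_trans (way_below_le ra) aw.
  exact: le_trans (way_below_le rb) bw.
have le_s u v : way_below2 (u, v) (a, b) -> u <= s /\ v <= s.
  move=> /way_below2_interpolation[r [qr rab]].
  have [c [Cc [uc vc _] _]] := lowC _ _ qr rab.
  by split; [apply: le_trans uc _|apply: le_trans vc _]; exact: supC.1.
have [[u0 v0] [u0a v0b]] := way_below2_below (a, b).
split.
- by apply: supC.2 => c Cc; exact: C_le Cc (lexx z) az bz.
- move=> _ [->|->].
    by apply: (contL.2 a).2.2 => u ua; case: (le_s u v0).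
  by apply: (contL.2 b).2.2 => v vb; case: (le_s u0 v).
- move=> w wz ubw; apply: supC.2 => c Cc; apply: C_le Cc wz _ _; apply: ubw.
    by left.
  by right.
Qed.

Lemma bipointed_cmap (Y : choiceType) (u v z : L) (e : Y -> L) :
  (forall y, [/\ u <= e y, v <= e y & e y <= z]) -> u <= z -> v <= z ->
  exists g : cmap (alexandrov (@bipointed_le Y)) L,
    forall p, g p = match p with
                    | BLeft => u | BRight => v | BTop => z | BMid y => e y
                    end.
Proof.
move=> euvz uz vz.
apply: alexandrov_cmap => [[|||y]] [|||y'] //= le_pq.
- by case: (euvz y').
- by case: (euvz y').
- by case: (euvz y).
- by case: le_pq => ->.
Qed.

(** If [a] and [b] have no supremum below [z], then for some [q0 << r << (a, b)]
    the bounds of [r] have no lower bound among those of [q0]. The levels are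
    the [q] with [q0 <= q << r]. A continuous map whose values at the two lower
    points exceed [q] has all its middle values above [q], whereas the maps that
    defeat a finite set of coordinates take the values [q'] there, which is
    possible since their middle values lie above [q']. *)
Lemma isbell_scott_local_sup (z a b : L) :
  (forall X : topologicalType, RW_space X ->
     isbell_topology X L = scott_topology (cmap X L)) ->
  a <= z -> b <= z -> exists c, local_sup z [set a; b] c.
Proof.
move=> coincide az bz; apply: local_sup_of_lower_bounds => // q0 r q0r rab.
apply: contrapT => nb.
pose Q := {q : L * L | [/\ q0.1 <= q.1, q0.2 <= q.2 & way_below2 q r]}.
have q0Q : [/\ q0.1 <= q0.1, q0.2 <= q0.2 & way_below2 q0 r] by [].
have [raz rbz] : r.1 <= z /\ r.2 <= z.
  by split; [apply: le_trans az|apply: le_trans bz]; apply: way_below_le; case: rab.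
have [[q Qq] [[q' Qq'] [/= [qu qv] [Y [m [W sepW]]]]]] : exists q q' : Q,
    way_below2 (sval q) (sval q') /\
    separating [set c | (sval q).1 <= c /\ (sval q).2 <= c]
               (upper_bounds_below z (sval q')).
  apply: (@separating_levels d L Q (fun q q' => way_below2 (sval q) (sval q'))
    (fun q => [set c | (sval q).1 <= c /\ (sval q).2 <= c])
    (fun q => upper_bounds_below z (sval q)) (upper_bounds_below z r)
    (exist _ q0 q0Q)).
  - move=> [q Qq]; have [u0q v0q /way_below2_interpolation[q' [[qu qv] q'r]]] := Qq.
    have Qq' : [/\ q0.1 <= q'.1, q0.2 <= q'.2 & way_below2 q' r].
      by split=> //; [apply: le_trans u0q _|apply: le_trans v0q _]; exact: way_below_le.
    by exists (exist _ q' Qq').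
  - move=> q q' [/way_below_le uu /way_below_le vv] c [uc vc cz].
    by split=> //; [exact: le_trans uu uc|exact: le_trans vv vc].
  - by move=> q c [].
  - by move=> q c t [uc vc] [_ _ tz] ct; split=> //; exact: le_trans tz.
  - move=> [q Qq] c [uc vc cz]; have [_ _ [/way_below_le ur /way_below_le vr]] := Qq.
    by split=> //=; [exact: le_trans uc|exact: le_trans vc].
  - by exists z.
  - move=> [q Qq] [c [/= uc vc cz] low]; have [u0q v0q _] := Qq.
    apply: nb; exists c => //.
    by split=> //; [exact: le_trans uc|exact: le_trans vc].
have [_ _ [/way_below_le q'r1 /way_below_le q'r2]] := Qq'.
pose base (p : bipointed Y) : L :=
  match p with BLeft => q'.1 | BRight => q'.2 | _ => z end.
pose C := [set h : cmap (alexandrov (@bipointed_le Y)) L |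
  way_below q.1 (h BLeft) /\ way_below q.2 (h BRight)].
apply: (@separates_isbell_neq_scott _ _ contL (bipointed Y) (@bipointed_le Y)
  (@bipointed_le_refl Y) (@bipointed_le_trans Y) _ _ _ _ _ (@BMid Y) C base sepW).
- by move=> x y [].
- split=> [g h /cmap_leP gh [gu gv]|D s dirD supD [su sv]].
    by split; [exact: le_way_below (lexx _) gu (gh _)
              |exact: le_way_below (lexx _) gv (gh _)].
  have accs p u : way_below u (s p) -> exists2 h, D h & way_below u (h p).
    move=> us; have [_ [[h Dh <-] uh]] := (scott_open_way_above contL u).2 _ _
      (directed_at p dirD) (cmap_supremums_at contL.1 p dirD supD) us.
    by exists h.
  have [[g Dg gu] [h Dh hv]] := (accs _ _ su, accs _ _ sv).
  have [k [Dk /cmap_leP gk /cmap_leP hk]] := dirD.2 _ _ Dg Dh.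
  exists k; split=> //; split; first exact: le_way_below (lexx _) gu (gk _).
  exact: le_way_below (lexx _) hv (hk _).
- move=> h [/way_below_le hu /way_below_le hv] y; split.
    by apply: le_trans hu _; exact: alexandrov_cmap_mono.
  by apply: le_trans hv _; exact: alexandrov_cmap_mono.
- move=> e Me; have [||g gE] := @bipointed_cmap Y q'.1 q'.2 z e Me.
  + exact: le_trans raz.
  + exact: le_trans rbz.
  exists g; split=> [|y|[|||y] ny]; rewrite ?gE //; first by split; rewrite gE.
  by case: (ny y).
- apply: coincide; apply: (@alexandrov_RW_top _ _ (@bipointed_le_refl Y)
    (@bipointed_le_trans Y) BTop).
  by case.
Qed.

End LocalSups.

(** The elements below all upper bounds of [A] form a set that contains [A] and
    is directed, thanks to the least element and to suprema of pairs; its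
    supremum is that of [A]. Infima are suprema of sets of lower bounds. *)
Lemma L_dcpo_of_local_sup d (L : porderType d) : dcpo L ->
  (exists bot : L, forall x, bot <= x) ->
  (forall z a b : L, a <= z -> b <= z -> exists c, local_sup z [set a; b] c) ->
  L_dcpo L.
Proof.
move=> dcpoL [bot botP] sup2; split=> //.
have sup (z : L) (A : set (principal_ideal z)) : exists s, supremums A s.
  pose C := [set c | c <= z /\ forall w, ubound A w -> c <= val w].
  have dirC : directed C.
    split; first by exists bot; split.
    move=> c1 c2 [c1z c1A] [c2z c2A]; have [c [cz ubc lec]] := sup2 z c1 c2 c1z c2z.
    exists c; split; [split=> // w ubw| by apply: ubc; left|by apply: ubc; right].
    by apply: lec => [|_ [->|->]]; [exact: (valP w)|exact: c1A|exact: c2A].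
  have [s supC] := dcpoL C dirC.
  have sz : s <= z by apply: supC.2 => c [].
  exists (Sub s sz); split=> [a Aa|w ubw]; rewrite -Order.le_val.
    apply: supC.1; split; first exact: (valP a).
    by move=> w ubw; rewrite Order.le_val; exact: ubw.
  by apply: supC.2 => c [_]; apply.
move=> z A; split; first exact: sup.
have [i [ubi lei]] := sup z (lbound A); exists i; split=> [a Aa|w lbw].
  by apply: lei => w lbw; exact: lbw.
exact: ubi.
Qed.

Theorem theorem1p3 (d : Order.disp_t) (L : porderType d)
    (L_nonempty : [set: L] !=set0) (L_continuous : continuous_dcpo L) :
  (forall X : topologicalType, RW_space X ->
     isbell_topology X L = scott_topology (cmap X L))
  <->
  pointed_dcpo L /\ continuous_L_domain L.
Proof.
split=> [coincide|[[_ botL] [_ LL]] X [ccX rwX]].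
  have botL := isbell_scott_pointed L_continuous L_nonempty coincide.
  split; first by split=> //; exact: L_continuous.1.
  split=> //; apply: L_dcpo_of_local_sup L_continuous.1 botL _ => z a b.
  exact: isbell_scott_local_sup.
apply/seteqP; split; first exact: isbell_subset_scott L_continuous.1.
exact: scott_subset_isbell.
Qed.
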